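(* Let $A$ be a Banach algebra and let $J$ be a closed two-sided ideal in $A$ with a bounded approximate identity. Then for every closed two-sided ideal $I$ in $J$, the Banach algebra $J$ is $I$-weakly amenable if and only if $A$ is $I$-weakly amenable.
   Context: For a Banach algebra $B$ and a Banach $B$-bimodule $X$ (jointly continuous module operations), the dual $X^*$ is a Banach $B$-bimodule via $\langle x,b\cdot x^*\rangle=\langle x\cdot b,x^*\rangle$ and $\langle x,x^*\cdot b\rangle=\langle b\cdot x,x^*\rangle$. A derivation $D:B\to X$ is a continuous linear map with $D(ab)=a\cdot D(b)+D(a)\cdot b$ for all $a,b\in B$; it is inner if there is $x\in X$ with $D(b)=b\cdot x-x\cdot b$ for all $b\in B$. $H^1(B,X)=\{0\}$ means every derivation $B\to X$ is inner. For a closed two-sided ideal $I$ of $B$ (a Banach $B$-bimodule under multiplication), $B$ is $I$-weakly amenable if $H^1(B,I^* )=\{0\}$. A bounded approximate identity is a two-sided one. Since $J$ has a bounded approximate identity, a closed two-sided ideal $I$ of $J$ is also a closed two-sided ideal of $A$, so that $I$-weak amenability of $A$ makes sense. *)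

(* Defs.v *)
From HB Require Import structures.
From mathcomp Require Import all_boot all_order all_algebra.
From mathcomp Require Import complex.
From mathcomp Require Import boolp classical_sets functions reals.
From mathcomp Require Import prodnormedzmodule topology normedtype.

Set Implicit Arguments.
Unset Strict Implicit.
Unset Printing Implicit Defensive.

Import Order.TTheory GRing.Theory Num.Theory.
Local Open Scope classical_set_scope.
Local Open Scope ring_scope.

Variant scalar_kind := Real | Complex.

Definition scalar_field (R : realType) (k : scalar_kind) : numFieldType :=
  match k with Real => R | Complex => R[i]%C end.

(* The norms below take their values in [scalar_field R k]; in the complex case the
   order is the partial one of [R[i]], where [0 <= x] forces [x] to be real. *)
Lemma scalar_has_supremum (R : realType) (k : scalar_kind)
    (A : set (scalar_field R k)) (M : scalar_field R k) :
  A !=set0 -> A `<=` [set x | 0 <= x] -> ubound A M ->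
  exists s, supremums A s.
Proof.
case: k A M => /= A M A0 Age0 AM.
  exists (sup A); split; first by apply: sup_upper_bound; split => //; exists M.
  by move=> y yA; exact: ge_sup.
have ReE (z : R[i]%C) : 0 <= z -> z = (complex.Re z)%:C%C.
  by case: z => a b; rewrite lecE /= => /andP[/eqP -> _].
pose B := [set complex.Re x | x in A].
have B0 : B !=set0 by case: A0 => x Ax; exists (complex.Re x); exists x.
have BM : ubound B (complex.Re M).
  by move=> _ [x Ax <-]; have := AM _ Ax; rewrite lecE => /andP[].
exists ((sup B)%:C)%C; split.
  move=> x Ax; rewrite (ReE _ (Age0 _ Ax)) lecR.
  by apply: sup_upper_bound; [split => //; exists (complex.Re M)|exists x].
move=> u uA; case: A0 => x Ax.
have u0 : 0 <= u := le_trans (Age0 _ Ax) (uA _ Ax).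
rewrite (ReE _ u0) lecR; apply: ge_sup => // _ [y Ay <-].
by have := uA _ Ay; rewrite lecE => /andP[].
Qed.

Lemma complex_complete (R : realType) (F : set_system (R[i]%C)^o) :
  ProperFilter F -> cauchy F -> cvg F.
Proof.
move=> FF /cauchy_ballP Fc.
have proj (p : R[i]%C -> R) : (forall x y, p (x - y) = p x - p y) ->
    (forall z, (`|p z|%:C)%C <= `|z|) ->
    exists l : R, forall e, 0 < e -> F [set z | `|l - p z| < e].
  move=> pB pn; pose G : set_system R^o := p @ F.
  have GF : ProperFilter G by exact: fmap_proper_filter.
  have : cauchy G.
    apply/cauchyP => e e0.
    have /Fc : 0 < (e%:C)%C :> R[i]%C by rewrite ltcR.
    move=> /(@nearP_dep _ _ F F) H; near F => x; exists (p x).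
    have Hx : \forall y \near F, ball (x : (R[i]%C)^o) (e%:C)%C y by near: x.
    change (\forall y \near F, `|p x - p y| < e).
    near=> y; rewrite -pB -ltcR (le_lt_trans (pn _))//.
    by near: y.
  move=> Gc.
  have Gl : (p : _ -> R^o) z @[z --> F] --> lim G := R_complete GF Gc.
  exists (lim G) => e e0.
  have H := iffLR (@cvgrPdist_lt R R^o _ F _ (p : _ -> R^o) (lim G)) Gl.
  exact: H.
have ImB (z : R[i]%C) : (`|complex.Im z|%:C)%C <= `|z|.
  have -> : `|z| = `|z * 'i%C|.
    by rewrite normrM [X in _ * X](_ : _ = 1) ?mulr1// normc_def /= expr0n expr1n add0r sqrtr1.
  have -> : complex.Im z = - complex.Re (z * 'i%C).
    by case: z => a b /=; simpc.
  by rewrite normrN normc_ge_Re.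
have [r Fr] := proj (@complex.Re R) (fun x y => ltac:(by case: x y => ? ? []))
  (@normc_ge_Re R).
have [s Fs] := proj (@complex.Im R) (fun x y => ltac:(by case: x y => ? ? []))
  ImB.
apply/cvg_ex; exists (r +i* s)%C; apply/cvgrPdist_lt => e e0.
have eE : e = ((complex.Re e)%:C)%C.
  by move: e0; case: e => a b; rewrite ltcE /= => /andP[/eqP -> _].
have e1 : 0 < complex.Re e / 2 by rewrite divr_gt0// -ltcR -eE.
have splitE z : (r +i* s)%C - z = (r - complex.Re z)%:C%C +
    'i%C * (s - complex.Im z)%:C%C :> R[i]%C.
  by case: z => a b /=; simpc.
near=> z; rewrite splitE.
rewrite (le_lt_trans (ler_normD _ _))// normrM [X in X * _](_ : _ = 1) ?mul1r; last first.
  by rewrite normc_def /= expr0n expr1n add0r sqrtr1.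
rewrite !normc_def/= expr0n/= !addr0 !sqrtr_sqr -rmorphD/= eE ltcR [ltRHS]splitr.
by rewrite ltrD//; near: z; [exact: Fr|exact: Fs].
Unshelve. all: by end_near. Qed.

Lemma scalar_complete (R : realType) (k : scalar_kind)
    (F : set_system (scalar_field R k)^o) :
  ProperFilter F -> cauchy F -> cvg F.
Proof. by case: k F => /= F; [exact: R_complete|exact: complex_complete]. Qed.

Section BilinearMaps.
Variables (K : numFieldType) (U V W : normedModType K) (f : U -> V -> W).
Hypothesis f_linl : forall v, linear (f^~ v).
Hypothesis f_linr : forall u, linear (f u).

Let fZl a u v : f (a *: u) v = a *: f u v.
Proof.
have f0 : f 0 v = 0.
  by have := f_linl v (-1) 0 0; rewrite /= scaler0 addr0 scaleN1r addNr.
by have := f_linl v a u 0; rewrite /= f0 !addr0.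
Qed.

Let fZr a u v : f u (a *: v) = a *: f u v.
Proof.
have f0 : f u 0 = 0.
  by have := f_linr u (-1) 0 0; rewrite /= scaler0 addr0 scaleN1r addNr.
by have := f_linr u a v 0; rewrite /= f0 !addr0.
Qed.

Let fBl u u' v : f (u - u') v = f u v - f u' v.
Proof. by have := f_linl v (-1) u' u; rewrite /= !scaleN1r !(addrC (- _)). Qed.

Let fBr u v v' : f u (v - v') = f u v - f u v'.
Proof. by have := f_linr u (-1) v' v; rewrite /= !scaleN1r !(addrC (- _)). Qed.

Lemma bilinear_continuous_bounded :
  continuous (fun p : U * V => f p.1 p.2) ->
  exists2 M, 0 < M & forall u v, `|f u v| <= M * (`|u| * `|v|).
Proof.
move=> /(_ (0, 0)) /cvgrPdist_lt /(_ 1 ltr01) /=.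
have f00 : f 0 0 = 0 by rewrite -[X in f X _](scale0r 0) fZl scale0r.
rewrite f00 => /nbhs_normP[/= d d0 fd].
have fd1 u v : `|u| < d -> `|v| < d -> `|f u v| <= 1.
  move=> ud vd; rewrite -normrN -sub0r; apply/ltW/(fd (u, v)).
  rewrite /ball_/= prod_normE /= !sub0r !normrN.
  by rewrite comparable_gt_max ?ud ?vd ?real_comparable ?normr_real.
have e0 : 0 < d / 2 by rewrite divr_gt0.
have ed : d / 2 < d by rewrite ltr_pdivrMr// ltr_pMr// ltr1n.
exists ((d / 2)^-1 * (d / 2)^-1) => [|u v]; first by rewrite mulr_gt0 ?invr_gt0.
have [->|u0] := eqVneq u 0.
  by rewrite -[X in f X _](scale0r 0) fZl scale0r !normr0 mul0r mulr0.
have [->|v0] := eqVneq v 0.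
  by rewrite -[X in f _ X](scale0r 0) fZr scale0r !normr0 !mulr0.
have nu : 0 < `|u| by rewrite normr_gt0.
have nv : 0 < `|v| by rewrite normr_gt0.
have small (Z : normedModType K) (z : Z) : 0 < `|z| ->
    `|(d / 2 / `|z|) *: z| < d.
  by move=> z0; rewrite normrZ ger0_norm ?divr_ge0 ?ltW// divfK// gt_eqF.
have := fd1 _ _ (small _ u nu) (small _ v nv).
rewrite fZl fZr !normrZ !gtr0_norm ?divr_gt0//.
rewrite [X in X <= 1 -> _]mulrA.
rewrite -ler_pdivlMl ?mulr_gt0 ?divr_gt0 ?invr_gt0// => /le_trans; apply.
by rewrite mulr1 !invfM !invrK mulrACA.
Qed.

Lemma bilinear_bounded_continuous (M : K) :
  (forall u v, `|f u v| <= M * (`|u| * `|v|)) ->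
  continuous (fun p : U * V => f p.1 p.2).
Proof.
move=> fM [u0 v0] /=; pose N := `|M| + 1.
have N0 : 0 < N by rewrite ltr_wpDl.
have fN u v : `|f u v| <= N * (`|u| * `|v|).
  have [->|u_0] := eqVneq u 0.
    by rewrite -[X in f X _](scale0r 0) fZl scale0r !normr0 mul0r mulr0.
  have [->|v_0] := eqVneq v 0.
    by rewrite -[X in f _ X](scale0r 0) fZr scale0r !normr0 !mulr0.
  rewrite (le_trans (fM u v))// ler_pM2r ?mulr_gt0 ?normr_gt0//.
  have : 0 <= M.
    by rewrite -(pmulr_lge0 _ (_ : 0 < `|u| * `|v|)) ?mulr_gt0 ?normr_gt0//
      (le_trans _ (fM u v)).
  by move=> M0; rewrite /N ger0_norm// lerDl.
apply/cvgrPdist_lt => e e0.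
pose A := N * (`|v0| + 1 + `|u0|).
have A0 : 0 < A by rewrite mulr_gt0// ltr_wpDr// ltr_wpDl.
near=> p.
have -> : f u0 v0 - f p.1 p.2 = f (u0 - p.1) p.2 + f u0 (v0 - p.2).
  by rewrite fBl fBr [RHS]addrC subrKA.
have pu : `|u0 - p.1| < e / A.
  by near: p; apply: cvgr_dist_lt; [exact: cvg_fst|rewrite divr_gt0].
have pv : `|v0 - p.2| < e / A.
  by near: p; apply: cvgr_dist_lt; [exact: cvg_snd|rewrite divr_gt0].
have pv1 : `|p.2| <= `|v0| + 1.
  rewrite -lerBlDl (le_trans (lerB_dist _ _))// distrC ltW//.
  by near: p; apply: cvgr_dist_lt; [exact: cvg_snd|].
rewrite (le_lt_trans (ler_normD _ _))//.
rewrite (@le_lt_trans _ _ (N * (`|u0 - p.1| * (`|v0| + 1) +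
    `|u0| * `|v0 - p.2|)))//.
  rewrite mulrDr lerD// (le_trans (fN _ _))// ler_pM2l// ler_wpM2l//.
have eE : e = N * (e / A * (`|v0| + 1 + `|u0|)).
  by rewrite mulrCA -/A divfK// gt_eqF.
rewrite [ltRHS]eE ltr_pM2l// [ltRHS]mulrDr ltr_leD//.
  by rewrite ltr_pM2r// ltr_wpDl.
by rewrite mulrC ler_wpM2r// ltW.
Unshelve. all: by end_near. Qed.

End BilinearMaps.

(* The rings of MathComp are unital, hence the separate multiplication. *)
HB.mixin Record CompleteNormedModule_isBanachAlgebra (K : numFieldType) A
    of CompleteNormedModule K A := {
  bmul : A -> A -> A;
  bmulA : associative bmul;
  bmul_linearl : forall b, linear (bmul^~ b);
  bmul_linearr : forall a, linear (bmul a);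
  normr_bmul_le : forall a b, `|bmul a b| <= `|a| * `|b|
}.

#[short(type="banachAlgType")]
HB.structure Definition BanachAlgebra (K : numFieldType) :=
  {A of CompleteNormedModule_isBanachAlgebra K A & CompleteNormedModule K A}.

Declare Scope banach_scope.
Delimit Scope banach_scope with B.
Local Open Scope banach_scope.
Notation "a ** b" := (bmul a b)
  (at level 40, left associativity) : banach_scope.

(* The coercion to [set B] would let [set_type] turn an ideal into a bare type;
   the Banach algebra carried by [I] is [ideal_type I]. *)
Record closed_ideal (K : numFieldType) (B : banachAlgType K) := ClosedIdeal {
  ideal_set :> set B;
  ideal0 : ideal_set 0;
  ideal_lin : forall (k : K) x y,
    ideal_set x -> ideal_set y -> ideal_set (k *: x + y);
  ideal_mull : forall b x, ideal_set x -> ideal_set (b ** x);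
  ideal_mulr : forall b x, ideal_set x -> ideal_set (x ** b);
  ideal_closed : closed ideal_set
}.

Section IdealType.
Variables (K : numFieldType) (B : banachAlgType K) (I : closed_ideal B).

Definition ideal_pred : {pred B} := mem (ideal_set I).

Record ideal_type := IdealType {
  ideal_val :> B;
  ideal_valP : ideal_val \in ideal_pred
}.

HB.instance Definition _ := [isSub for ideal_val].
HB.instance Definition _ := [Choice of ideal_type by <:].

Lemma ideal_pred_submod_closed : submod_closed ideal_pred.
Proof.
split=> [|k x y]; rewrite !inE; first exact: ideal0.
exact: ideal_lin.
Qed.

HB.instance Definition _ :=
  GRing.isSubmodClosed.Build K B ideal_pred ideal_pred_submod_closed.
HB.instance Definition _ := [SubChoice_isSubLmodule of ideal_type by <:].

Let norm (x : ideal_type) : K := `|ideal_val x|.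

Let norm_triangle x y : norm (x + y) <= norm x + norm y.
Proof. exact: ler_normD. Qed.

Let norm_scale (k : K) x : norm (k *: x) = `|k| * norm x.
Proof. exact: normrZ. Qed.

Let norm_eq0 x : norm x = 0 -> x = 0.
Proof. by move=> /normr0_eq0 x0; exact: val_inj. Qed.

HB.instance Definition _ :=
  Lmodule_isNormed.Build K ideal_type norm_triangle norm_scale norm_eq0.

Lemma ideal_setP (x : ideal_type) : ideal_set I (ideal_val x).
Proof. by have := ideal_valP x; rewrite inE. Qed.

Definition to_ideal (x : B) (Ix : ideal_set I x) : ideal_type :=
  IdealType (mem_set Ix).

Let ideal_complete (F : set_system ideal_type) :
  ProperFilter F -> cauchy F -> cvg F.
Proof.
move=> FF /cauchy_ballP Fc; pose G : set_system B := ideal_val @ F.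
have GF : ProperFilter G by exact: fmap_proper_filter.
have Gc : cauchy G.
  apply/cauchyP => e e0; have /(@nearP_dep _ _ F F) H := Fc e e0.
  near F => x; exists (ideal_val x).
  change (\forall y \near F, ball (ideal_val x) e (ideal_val y)).
  have Hx : \forall y \near F, ball x e y by near: x.
  near=> y; have : ball x e y by near: y.
  by rewrite -!ball_normE.
have Gl : ideal_val z @[z --> F] --> lim G :=
  @cauchy_cvg _ G GF Gc.
have Il : ideal_set I (lim G).
  apply: (@closed_cvg _ _ F FF ideal_val (ideal_set I)) => //.
  - exact: ideal_closed.
  - by near=> z; exact: ideal_setP.
apply/cvg_ex; exists (to_ideal Il); apply/cvgrPdist_lt => e e0.
exact: (iffLR (@cvgrPdist_lt _ _ _ F _ ideal_val (lim G)) Gl).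
Unshelve. all: by end_near. Qed.

HB.instance Definition _ := Uniform_isComplete.Build ideal_type ideal_complete.

Let imul (x y : ideal_type) : ideal_type :=
  to_ideal (ideal_mulr (ideal_val y) (ideal_setP x)).

Let imulA : associative imul.
Proof. by move=> x y z; apply: val_inj; exact: bmulA. Qed.

Let imul_linearl y : linear (imul^~ y).
Proof. by move=> k x z; apply: val_inj; exact: bmul_linearl. Qed.

Let imul_linearr x : linear (imul x).
Proof. by move=> k y z; apply: val_inj; exact: bmul_linearr. Qed.

Let normr_imul_le x y : `|imul x y| <= `|x| * `|y|.
Proof. exact: normr_bmul_le. Qed.

HB.instance Definition _ := CompleteNormedModule_isBanachAlgebra.Build K
  ideal_type imulA imul_linearl imul_linearr normr_imul_le.

End IdealType.

Record banach_bimodule (K : numFieldType) (B : banachAlgType K) :=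
  BanachBimodule {
  bimod_sort :> completeNormedModType K;
  lact : B -> bimod_sort -> bimod_sort;
  ract : bimod_sort -> B -> bimod_sort;
  lact_linearl : forall x, linear (lact^~ x);
  lact_linearr : forall b, linear (lact b);
  ract_linearl : forall b, linear (ract^~ b);
  ract_linearr : forall x, linear (ract x);
  lactA : forall a b x, lact a (lact b x) = lact (a ** b) x;
  ractA : forall x a b, ract (ract x a) b = ract x (a ** b);
  lract : forall a x b, ract (lact a x) b = lact a (ract x b);
  lact_continuous : continuous (fun p : B * bimod_sort => lact p.1 p.2);
  ract_continuous : continuous (fun p : bimod_sort * B => ract p.1 p.2)
}.

Notation "b *>> x" := (lact b x)
  (at level 40, left associativity) : banach_scope.
Notation "x <<* b" := (ract x b)
  (at level 40, left associativity) : banach_scope.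

Section Derivations.
Variables (K : numFieldType) (B : banachAlgType K) (X : banach_bimodule B).

Definition derivation (D : B -> X) :=
  [/\ linear D, continuous D & forall a b, D (a ** b) = a *>> D b + D a <<* b].

Definition inner_derivation (D : B -> X) :=
  exists x : X, forall b, D b = b *>> x - x <<* b.

Definition H1_trivial := forall D : B -> X, derivation D -> inner_derivation D.

End Derivations.

Section IdealBimodule.
Variables (K : numFieldType) (B : banachAlgType K) (I : closed_ideal B).

Let ilact (b : B) (x : ideal_type I) : ideal_type I :=
  to_ideal (ideal_mull b (ideal_setP x)).

Let iract (x : ideal_type I) (b : B) : ideal_type I :=
  to_ideal (ideal_mulr b (ideal_setP x)).

Let ilact_linearl x : linear (ilact^~ x).
Proof. by move=> k a b; apply: val_inj; exact: bmul_linearl. Qed.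

Let ilact_linearr b : linear (ilact b).
Proof. by move=> k x y; apply: val_inj; exact: bmul_linearr. Qed.

Let iract_linearl b : linear (iract^~ b).
Proof. by move=> k x y; apply: val_inj; exact: bmul_linearl. Qed.

Let iract_linearr x : linear (iract x).
Proof. by move=> k a b; apply: val_inj; exact: bmul_linearr. Qed.

Let ilactA a b x : ilact a (ilact b x) = ilact (a ** b) x.
Proof. by apply: val_inj; exact: bmulA. Qed.

Let iractA x a b : iract (iract x a) b = iract x (a ** b).
Proof. by apply: val_inj; symmetry; exact: bmulA. Qed.

Let ilract a x b : iract (ilact a x) b = ilact a (iract x b).
Proof. by apply: val_inj; symmetry; exact: bmulA. Qed.

Let ilact_continuous :
  continuous (fun p : B * ideal_type I => ilact p.1 p.2).
Proof.
apply: (@bilinear_bounded_continuous _ _ _ _ _ ilact_linearl ilact_linearr 1).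
by move=> b x; rewrite mul1r; exact: normr_bmul_le.
Qed.

Let iract_continuous :
  continuous (fun p : ideal_type I * B => iract p.1 p.2).
Proof.
apply: (@bilinear_bounded_continuous _ _ _ _ _ iract_linearl iract_linearr 1).
by move=> x b; rewrite mul1r; exact: normr_bmul_le.
Qed.

Definition ideal_bimodule : banach_bimodule B :=
  @BanachBimodule K B (ideal_type I) ilact iract
    ilact_linearl ilact_linearr iract_linearl iract_linearr
    ilactA iractA ilract ilact_continuous iract_continuous.

End IdealBimodule.

Section DualSpace.
Variables (R : realType) (k : scalar_kind).
Let K : numFieldType := scalar_field R k.
Variable X : normedModType K.

Definition dual_pred : {pred X -> K^o} :=
  mem [set f : X -> K^o | linear f /\ continuous f].

Record dual_space := Dual {
  dual_fun :> X -> K^o;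
  dual_funP : dual_fun \in dual_pred
}.

HB.instance Definition _ := [isSub for dual_fun].
HB.instance Definition _ := [Choice of dual_space by <:].

Lemma dual_pred_submod_closed : submod_closed dual_pred.
Proof.
split=> [|c f g]; rewrite !inE.
  split; last by move=> x; exact: cst_continuous.
  by move=> a x y; rewrite /= scaler0 addr0.
move=> [fl fc] [gl gc]; split=> [a x y|x].
  by rewrite !fctE fl gl !scalerDr addrACA !scalerA mulrC.
by apply: cvgD; [apply: cvgZl_tmp; exact: fc|exact: gc].
Qed.

HB.instance Definition _ :=
  GRing.isSubmodClosed.Build K (X -> K^o) dual_pred dual_pred_submod_closed.
HB.instance Definition _ := [SubChoice_isSubLmodule of dual_space by <:].

Lemma dual_linear (f : dual_space) : linear f.
Proof. by have := dual_funP f; rewrite inE => -[]. Qed.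

Lemma dual_continuous (f : dual_space) : continuous f.
Proof. by have := dual_funP f; rewrite inE => -[]. Qed.

Lemma bounded_in_dual (f : X -> K^o) (M : K) : 0 <= M -> linear f ->
  (forall x, `|f x| <= M * `|x|) -> f \in dual_pred.
Proof.
move=> M0 fl fM; rewrite inE; split=> //.
pose Lf : {linear X -> K^o} := HB.pack f (GRing.isLinear.Build _ _ _ _ _ fl).
apply: (@bounded_linear_continuous _ _ _ Lf); apply/linear_boundedP.
near=> r; move=> x /=; rewrite (le_trans (fM x))// ler_wpM2r//.
by near: r; apply: nbhs_pinfty_ge; rewrite ger0_real.
Unshelve. all: by end_near. Qed.

Definition opnorm (f : X -> K^o) : K :=
  supremum 0 [set `|f x| | x in [set x | `|x| <= 1]].

Section Opnorm.
Variable f : dual_space.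

Let Lf : {linear X -> K^o} :=
  HB.pack (dual_fun f) (GRing.isLinear.Build _ _ _ _ _ (dual_linear f)).

Lemma dualZ (a : K) x : f (a *: x) = a *: f x.
Proof. exact: (linearZZ Lf). Qed.

Lemma dualB x y : f (x - y) = f x - f y.
Proof. exact: (linearB Lf). Qed.

Lemma dual0 : f 0 = 0.
Proof. exact: (linear0 Lf). Qed.

Lemma dual_bounded : exists2 M, 0 < M & forall x, `|f x| <= M * `|x|.
Proof.
have /linear_boundedP/pinfty_ex_gt0[M M0 fM] : bounded_near Lf (nbhs 0).
  by apply: continuous_linear_bounded; exact: dual_continuous.
by exists M.
Qed.

Lemma opnorm_supremums :
  supremums [set `|f x| | x in [set x | `|x| <= 1]] (opnorm f).
Proof.
rewrite /opnorm /supremum; case: ifPn => [/eqP A0|_].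
  have : [set `|f x| | x in [set x | `|x| <= 1]] `|f 0|.
    by exists 0 => //=; rewrite normr0.
  by rewrite A0.
have [M M0 fM] := dual_bounded.
have [s As] : exists s,
    supremums [set `|f x| | x in [set x | `|x| <= 1]] s.
  apply: (@scalar_has_supremum R k _ M).
  - by exists `|f 0|; exists 0 => //=; rewrite normr0.
  - by move=> _ [x _ <-] /=.
  - move=> _ [x /= x1 <-]; rewrite (le_trans (fM x))//.
    by rewrite -[leRHS]mulr1 ler_pM2l.
exact: (xgetPex 0 (ex_intro _ s As)).
Qed.

Lemma opnorm_ge0 : 0 <= opnorm f.
Proof.
rewrite (@le_trans _ _ `|f 0|)//; apply: opnorm_supremums.1.
by exists 0 => //=; rewrite normr0.
Qed.

Lemma le_opnorm x : `|f x| <= opnorm f * `|x|.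
Proof.
have [->|x0] := eqVneq x 0; first by rewrite dual0 !normr0 mulr0.
have nx : 0 < `|x| by rewrite normr_gt0.
have : `|f (`|x|^-1 *: x)| <= opnorm f.
  apply: opnorm_supremums.1; exists (`|x|^-1 *: x) => //=.
  by rewrite normrZ gtr0_norm ?invr_gt0// mulVf// gt_eqF.
rewrite dualZ normrZ gtr0_norm ?invr_gt0//.
by rewrite ler_pdivrMl// mulrC.
Qed.

Lemma opnorm_le M : 0 <= M -> (forall x, `|f x| <= M * `|x|) -> opnorm f <= M.
Proof.
move=> M0 fM; apply: opnorm_supremums.2 => _ [x /= x1 <-].
by rewrite (le_trans (fM x))// -[leRHS]mulr1 ler_wpM2l.
Qed.

End Opnorm.

Let norm (f : dual_space) : K := opnorm f.

Let norm_triangle f g : norm (f + g) <= norm f + norm g.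
Proof.
apply: opnorm_le => [|x]; first by rewrite addr_ge0 ?opnorm_ge0.
by rewrite (le_trans (ler_normD _ _))// mulrDl lerD ?le_opnorm.
Qed.

Let norm_scale_le (a : K) f : norm (a *: f) <= `|a| * norm f.
Proof.
apply: opnorm_le => [|x]; first by rewrite mulr_ge0 ?opnorm_ge0.
by rewrite [X in X <= _]normrZ -mulrA ler_wpM2l ?le_opnorm.
Qed.

Let norm_scale (a : K) f : norm (a *: f) = `|a| * norm f.
Proof.
apply/le_anti; rewrite norm_scale_le /=.
have [->|a0] := eqVneq a 0; first by rewrite normr0 mul0r opnorm_ge0.
have := norm_scale_le a^-1 (a *: f).
by rewrite scalerK// normfV ler_pdivlMl ?normr_gt0.
Qed.

Let norm_eq0 f : norm f = 0 -> f = 0.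
Proof.
move=> f0; apply: val_inj; apply/funext => x /=.
have := le_opnorm f x; rewrite -/(norm f) f0 mul0r normr_le0 => /eqP //.
Qed.

HB.instance Definition _ :=
  Lmodule_isNormed.Build K dual_space norm_triangle norm_scale norm_eq0.

Lemma dual_normE (f : dual_space) : `|f| = opnorm f. Proof. by []. Qed.

Let dual_complete (F : set_system dual_space) :
  ProperFilter F -> cauchy F -> cvg F.
Proof.
move=> FF /cauchy_ballP Fc.
have /choice[l Fl] : forall x, exists l : K^o, (f : dual_space) x @[f --> F] --> l.
  move=> x; pose G : set_system K^o := (fun f : dual_space => f x) @ F.
  have GF : ProperFilter G by exact: fmap_proper_filter.
  suff Gc : cauchy G by exists (lim G); exact: (@scalar_complete R k G GF Gc).
  apply/cauchyP => e e0.
  have d0 : 0 < e / (`|x| + 1) by rewrite divr_gt0// ltr_wpDl.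
  have /(@nearP_dep _ _ F F) H := Fc _ d0.
  near F => f; exists (f x).
  change (F [set g : dual_space | `|f x - g x| < e]).
  have Hf : \forall g \near F, ball f (e / (`|x| + 1)) g by near: f.
  near=> g; have : ball f (e / (`|x| + 1)) g by near: g.
  rewrite -ball_normE /ball_/= ltr_pdivlMr ?ltr_wpDl//.
  apply: le_lt_trans; rewrite (le_trans (le_opnorm (f - g) x))//.
  by rewrite ler_wpM2l ?opnorm_ge0// lerDl.
have l_lin : linear l.
  move=> a x y; apply: (@cvg_unique _ (@norm_hausdorff K K^o) _ _ _ _ (Fl _)).
  rewrite (_ : (fun f : dual_space => f (a *: x + y)) =
    (fun f : dual_space => a *: f x + f y)); last first.
    by apply/funext => f; exact: dual_linear.
  by apply: cvgD; [apply: cvgZl_tmp; exact: Fl|exact: Fl].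
have unif e : 0 < e ->
    F [set f : dual_space | forall x, `|l x - f x| <= e * `|x|].
  move=> e0; have /(@nearP_dep _ _ F F) H := Fc _ e0.
  near=> f; move=> /= x; apply/ler_addgt0Pr => d d0.
  have Hf : \forall g \near F, ball f e g by near: f.
  near F => g.
  have lg : `|l x - g x| < d.
    by near: g; exact: (iffLR (@cvgrPdist_lt K K^o _ F _ _ (l x)) (Fl x)).
  have fg : `|f - g| < e.
    have : ball f e g by near: g.
    by rewrite -ball_normE.
  have gf : `|g x - f x| <= e * `|x|.
    rewrite distrC; apply: (le_trans (le_opnorm (f - g) x)).
    by rewrite ler_wpM2r// ltW.
  by rewrite (le_trans (ler_distD (g x) _ _))// [leRHS]addrC lerD// ltW.
have lP : l \in dual_pred.
  have F1 := unif 1 ltr01; near F => f.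
  have lf x : `|l x - f x| <= 1 * `|x| by move: x; near: f.
  apply: (@bounded_in_dual _ (1 + opnorm f)) => // [|x].
    by rewrite addr_ge0 ?opnorm_ge0.
  rewrite -[l x](subrK (f x)) (le_trans (ler_normD _ _))//.
  by rewrite (le_trans (lerD (lf x) (le_opnorm f x)))// -mulrDl.
apply/cvg_ex; exists (Dual lP); apply/cvgrPdist_lt => e e0.
have e20 : 0 < e / 2 by rewrite divr_gt0.
have Fe := unif _ e20; near=> f.
rewrite (@le_lt_trans _ _ (e / 2))//; last by rewrite ltr_pdivrMr// ltr_pMr// ltr1n.
apply: (@opnorm_le (Dual lP - f)); first exact: ltW.
by near: f.
Unshelve. all: by end_near. Qed.

HB.instance Definition _ := Uniform_isComplete.Build dual_space dual_complete.

End DualSpace.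

Arguments dual_pred {R k} X _.

Section DualBimodule.
Variables (R : realType) (k : scalar_kind).
Let K : numFieldType := scalar_field R k.
Variables (B : banachAlgType K) (X : banach_bimodule B).


Let lact_bounded :
  exists2 M : K, 0 < M & forall b (x : X), `|b *>> x| <= M * (`|b| * `|x|).
Proof.
exact: (bilinear_continuous_bounded (@lact_linearl _ _ X)
  (@lact_linearr _ _ X) (@lact_continuous _ _ X)).
Qed.

Let ract_bounded :
  exists2 M : K, 0 < M & forall (x : X) b, `|x <<* b| <= M * (`|x| * `|b|).
Proof.
exact: (bilinear_continuous_bounded (@ract_linearl _ _ X)
  (@ract_linearr _ _ X) (@ract_continuous _ _ X)).
Qed.

Let dlact_fun (b : B) (f : dual_space X) : X -> K^o := fun x => f (x <<* b).
Let dract_fun (f : dual_space X) (b : B) : X -> K^o := fun x => f (b *>> x).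

Let dlact_funP b f : dlact_fun b f \in dual_pred X.
Proof.
have [M M0 XM] := ract_bounded.
apply: (@bounded_in_dual _ _ _ _ (opnorm f * (M * `|b|))).
- by rewrite !mulr_ge0 ?opnorm_ge0// ltW.
- by move=> a x y; rewrite /dlact_fun ract_linearl dual_linear.
- move=> x; rewrite (le_trans (le_opnorm _ _))// -!mulrA ler_wpM2l ?opnorm_ge0//.
  by rewrite [`|b| * _]mulrC.
Qed.

Let dract_funP f b : dract_fun f b \in dual_pred X.
Proof.
have [M M0 XM] := lact_bounded.
apply: (@bounded_in_dual _ _ _ _ (opnorm f * (M * `|b|))).
- by rewrite !mulr_ge0 ?opnorm_ge0// ltW.
- by move=> a x y; rewrite /dract_fun lact_linearr dual_linear.
- by move=> x; rewrite (le_trans (le_opnorm _ _))// -!mulrA ler_wpM2l ?opnorm_ge0.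
Qed.

Definition dual_lact (b : B) (f : dual_space X) : dual_space X := Dual (dlact_funP b f).
Definition dual_ract (f : dual_space X) (b : B) : dual_space X := Dual (dract_funP f b).

Lemma dual_lactE b f x : dual_lact b f x = f (x <<* b). Proof. by []. Qed.
Lemma dual_ractE f b x : dual_ract f b x = f (b *>> x). Proof. by []. Qed.

Let dlact_linearl f : linear (dual_lact^~ f).
Proof.
by move=> c a b; apply: val_inj; apply/funext => x /=;
  rewrite /dlact_fun ract_linearr dual_linear.
Qed.

Let dlact_linearr b : linear (dual_lact b).
Proof. by move=> c f g; apply: val_inj; apply/funext. Qed.

Let dract_linearl b : linear (dual_ract^~ b).
Proof. by move=> c f g; apply: val_inj; apply/funext. Qed.

Let dract_linearr f : linear (dual_ract f).
Proof.
by move=> c a b; apply: val_inj; apply/funext => x /=;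
  rewrite /dract_fun lact_linearl dual_linear.
Qed.

Let dlactA a b f : dual_lact a (dual_lact b f) = dual_lact (a ** b) f.
Proof.
by apply: val_inj; apply/funext => x /=; rewrite /dlact_fun /= /dlact_fun ractA.
Qed.

Let dractA f a b : dual_ract (dual_ract f a) b = dual_ract f (a ** b).
Proof.
by apply: val_inj; apply/funext => x /=; rewrite /dract_fun /= /dract_fun lactA.
Qed.

Let dlract a f b : dual_ract (dual_lact a f) b = dual_lact a (dual_ract f b).
Proof.
by apply: val_inj; apply/funext => x /=;
  rewrite /dract_fun /dlact_fun /= /dract_fun /dlact_fun lract.
Qed.

Let dlact_continuous :
  continuous (fun p : B * dual_space X => dual_lact p.1 p.2).
Proof.
have [M M0 XM] := ract_bounded.
apply: (@bilinear_bounded_continuous _ _ _ _ _ dlact_linearl dlact_linearr M).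
move=> b f; apply: opnorm_le => [|x].
  by rewrite !mulr_ge0// ltW.
rewrite dual_lactE (le_trans (le_opnorm _ _))//.
rewrite (le_trans (ler_wpM2l (opnorm_ge0 f) (XM x b)))//.
by rewrite dual_normE [`|x| * _]mulrC !mulrA (mulrC (opnorm f)) [M * _ * _]mulrAC.
Qed.

Let dract_continuous :
  continuous (fun p : dual_space X * B => dual_ract p.1 p.2).
Proof.
have [M M0 XM] := lact_bounded.
apply: (@bilinear_bounded_continuous _ _ _ _ _ dract_linearl dract_linearr M).
move=> f b; apply: opnorm_le => [|x].
  by rewrite !mulr_ge0// ltW.
rewrite dual_ractE (le_trans (le_opnorm _ _))//.
rewrite (le_trans (ler_wpM2l (opnorm_ge0 f) (XM b x)))//.
by rewrite dual_normE !mulrA (mulrC (opnorm f)).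
Qed.

Definition dual_bimodule : banach_bimodule B :=
  @BanachBimodule K B (dual_space X) dual_lact dual_ract
    dlact_linearl dlact_linearr dract_linearl dract_linearr
    dlactA dractA dlract dlact_continuous dract_continuous.

End DualBimodule.

Definition ideal_weakly_amenable (R : realType) (k : scalar_kind)
    (B : banachAlgType (scalar_field R k)) (I : closed_ideal B) :=
  H1_trivial (dual_bimodule (ideal_bimodule I)).

Arguments ideal_weakly_amenable {R k} B I.

Definition directed (D : Type) (le : D -> D -> Prop) :=
  [/\ inhabited D, forall d, le d d,
      forall d1 d2 d3, le d1 d2 -> le d2 d3 -> le d1 d3 &
      forall d1 d2, exists d, le d1 d /\ le d2 d].

(* The filter generated by the tails of a net: convergence of [e] along
   [net_tails le] is convergence of the net [e]. *)
Definition net_tails (D : Type) (le : D -> D -> Prop) : set_system D :=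
  filter_from setT (fun d => [set d' | le d d']).

Lemma net_tails_filter (D : Type) (le : D -> D -> Prop) :
  directed le -> ProperFilter (net_tails le).
Proof.
move=> [[d0] leR leT leD]; apply: filter_from_proper.
  apply: filter_from_filter; first by exists d0.
  move=> d1 d2 _ _; have [d [d1d d2d]] := leD d1 d2; exists d => // d' /= dd'.
  by split; exact: leT dd'.
by move=> d _; exists d => /=.
Qed.

Definition has_bai (K : numFieldType) (B : banachAlgType K) :=
  exists (D : Type) (le : D -> D -> Prop) (e : D -> B) (M : K),
    [/\ directed le,
        forall d, `|e d| <= M,
        forall x, e d ** x @[d --> net_tails le] --> x &
        forall x, x ** e d @[d --> net_tails le] --> x].

Lemma closed_normP (K : numFieldType) (V : normedModType K) (A : set V) :
  closed A <->
  (forall x, (forall e, 0 < e -> exists2 y, A y & `|x - y| < e) -> A x).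
Proof.
split=> [Acl x xA|H x xA].
  apply: Acl => U /nbhs_normP[/= e e0 eU].
  by have [y Ay xy] := xA e e0; exists y; split => //; exact: eU.
apply: H => e e0.
have [y [Ay xy]] := xA _ (nbhsx_ballx x _ e0).
by exists y => //; move: xy; rewrite -ball_normE.
Qed.

(* A closed ideal [I] of [J] is a closed ideal of [A]: if [x] is in [I], then
   [a ** x] is the limit of [(a ** e d) ** x], where [a ** e d] is in [J]. *)
Section IdealLift.
Variables (K : numFieldType) (A : banachAlgType K) (J : closed_ideal A).
Hypothesis J_bai : has_bai (ideal_type J).
Variable I : closed_ideal (ideal_type J).

Let S : set A := [set ideal_val x | x in ideal_set I].

Let S0 : S 0. Proof. by exists 0 => //; exact: ideal0. Qed.

Let S_lin (k : K) x y : S x -> S y -> S (k *: x + y).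
Proof.
by move=> [u Iu <-] [v Iv <-]; exists (k *: u + v) => //; exact: ideal_lin.
Qed.

Let S_mull a x : S x -> S (a ** x).
Proof.
move=> [y Iy <-] {x}; have Jay := ideal_mull a (ideal_setP y).
exists (to_ideal Jay) => //; apply: (closed_normP _).1.
  exact: ideal_closed.
move=> r r0; have [D [le [e [M [dir _ ey _]]]]] := J_bai.
have FF := net_tails_filter dir; have [_ leR _ _] := dir.
have r1 : 0 < r / (`|a| + 1) by rewrite divr_gt0// ltr_wpDl.
have [d _ /(_ d (leR d)) /= ed] := iffLR (cvgrPdist_lt _ _) (ey y) _ r1.
exists (to_ideal (ideal_mull a (ideal_setP (e d))) ** y).
  exact: ideal_mull.
change (`|a ** ideal_val y - a ** ideal_val (e d) ** ideal_val y| < r).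
have -> : a ** ideal_val y - a ** ideal_val (e d) ** ideal_val y =
    a ** ideal_val (y - e d ** y).
  have := bmul_linearr a (-1) (ideal_val (e d ** y)) (ideal_val y).
  by rewrite !scaleN1r -bmulA ![- _ + _]addrC => <-.
rewrite (le_lt_trans (normr_bmul_le _ _))//.
have : `|ideal_val (y - e d ** y)| < r / (`|a| + 1) by [].
rewrite ltr_pdivlMr ?ltr_wpDl//; apply: le_lt_trans.
by rewrite mulrC ler_wpM2l// lerDl.
Qed.

Let S_mulr a x : S x -> S (x ** a).
Proof.
move=> [y Iy <-] {x}; have Jya := ideal_mulr a (ideal_setP y).
exists (to_ideal Jya) => //; apply: (closed_normP _).1.
  exact: ideal_closed.
move=> r r0; have [D [le [e [M [dir _ _ ye]]]]] := J_bai.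
have FF := net_tails_filter dir; have [_ leR _ _] := dir.
have r1 : 0 < r / (`|a| + 1) by rewrite divr_gt0// ltr_wpDl.
have [d _ /(_ d (leR d)) /= ed] := iffLR (cvgrPdist_lt _ _) (ye y) _ r1.
exists (y ** to_ideal (ideal_mulr a (ideal_setP (e d)))).
  exact: ideal_mulr.
change (`|ideal_val y ** a - ideal_val y ** (ideal_val (e d) ** a)| < r).
have -> : ideal_val y ** a - ideal_val y ** (ideal_val (e d) ** a) =
    ideal_val (y - y ** e d) ** a.
  have := bmul_linearl a (-1) (ideal_val (y ** e d)) (ideal_val y).
  by rewrite /= !scaleN1r bmulA ![- _ + _]addrC => <-.
rewrite (le_lt_trans (normr_bmul_le _ _))//.
have : `|ideal_val (y - y ** e d)| < r / (`|a| + 1) by [].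
rewrite ltr_pdivlMr ?ltr_wpDl//; apply: le_lt_trans.
by rewrite ler_wpM2l// lerDl.
Qed.

Let S_closed : closed S.
Proof.
apply/closed_normP => x Sx.
have Jx : ideal_set J x.
  apply: (closed_normP _).1.
  exact: ideal_closed.
  by move=> r /Sx[_ [y _ <-] xy]; exists (ideal_val y) => //; exact: ideal_setP.
exists (to_ideal Jx) => //; apply: (closed_normP _).1.
  exact: ideal_closed.
by move=> r /Sx[_ [y Iy <-] xy]; exists y.
Qed.

Definition ideal_lift : closed_ideal A :=
  ClosedIdeal S0 S_lin S_mull S_mulr S_closed.

End IdealLift.

(* Main.v *)
From HB Require Import structures.
Require Import Defs.
From mathcomp Require Import all_boot all_order all_algebra.
From mathcomp Require Import boolp classical_sets reals topology normedtype.

Set Implicit Arguments.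
Unset Strict Implicit.
Unset Printing Implicit Defensive.

Import Order.TTheory GRing.Theory Num.Theory.
Local Open Scope classical_set_scope.
Local Open Scope ring_scope.
Local Open Scope banach_scope.

(* Let [X] be a Banach [A]-bimodule on which the bounded approximate identity [e] of
   [J] acts as an approximate identity, so that [X * J] is dense in [X].
   If a derivation [D : A -> X^*] restricts on [J] to the inner derivation of [u],
   then the Leibniz rule for [j * a] determines [D a] on [X * J], where it agrees with
   the inner derivation of [u].
   Conversely, a derivation [D : J -> X^*] extends to [A] by
   [D' a x := lim_t (D (e t * a) x - D (e t) (a * x))]: by the Leibniz rule this limit
   exists on [X * J] and is [D' a (y * j) = D (j * a) y - D j (a * y)], the functionals
   are uniformly bounded, and this formula gives the derivation identity for [D'].
   The theorem is the case [X = I]. *)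

(** * Restriction of a Banach bimodule from [A] to the ideal [J] *)

Section RestrictBimodule.
Variables (K : numFieldType) (A : banachAlgType K) (J : closed_ideal A).
Variable X : banach_bimodule A.

Let rlact (j : ideal_type J) (x : X) : X := ideal_val j *>> x.
Let rract (x : X) (j : ideal_type J) : X := x <<* ideal_val j.

Let rlact_linearl x : linear (rlact^~ x).
Proof. by move=> c a b; exact: lact_linearl. Qed.

Let rlact_linearr j : linear (rlact j).
Proof. exact: lact_linearr. Qed.

Let rract_linearl j : linear (rract^~ j).
Proof. exact: ract_linearl. Qed.

Let rract_linearr x : linear (rract x).
Proof. by move=> c a b; exact: ract_linearr. Qed.

Let rlactA a b x : rlact a (rlact b x) = rlact (a ** b) x.
Proof. exact: lactA. Qed.

Let rractA x a b : rract (rract x a) b = rract x (a ** b).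
Proof. exact: ractA. Qed.

Let rlract a x b : rract (rlact a x) b = rlact a (rract x b).
Proof. exact: lract. Qed.

Let rlact_continuous : continuous (fun p : ideal_type J * X => rlact p.1 p.2).
Proof.
(* The norm of [ideal_type J] is that of [A], so a bound for the action of [A] serves for [J]. *)
have [M _ XM] := bilinear_continuous_bounded (@lact_linearl _ _ X)
  (@lact_linearr _ _ X) (@lact_continuous _ _ X).
apply: (bilinear_bounded_continuous rlact_linearl rlact_linearr (M := M)) => j x.
exact: XM.
Qed.

Let rract_continuous : continuous (fun p : X * ideal_type J => rract p.1 p.2).
Proof.
have [M _ XM] := bilinear_continuous_bounded (@ract_linearl _ _ X)
  (@ract_linearr _ _ X) (@ract_continuous _ _ X).
apply: (bilinear_bounded_continuous rract_linearl rract_linearr (M := M)) => x j.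
exact: XM.
Qed.

Definition restrict_bimodule : banach_bimodule (ideal_type J) :=
  BanachBimodule rlact_linearl rlact_linearr rract_linearl rract_linearr
    rlactA rractA rlract rlact_continuous rract_continuous.

End RestrictBimodule.

(** * Functionals on dense sets, pointwise limits and isometric isomorphisms *)

Section Dual.
Variables (R : realType) (k : scalar_kind).
Let K : numFieldType := scalar_field R k.

Lemma dual_ext (X : normedModType K) (f g : dual_space X) : f =1 g -> f = g.
Proof. by move=> fg; apply: val_inj; apply/funext. Qed.

(** For [y] in [S] near [x], [f x - g x] equals [(f - g) (x - y)], which the operator norm makes
    small. *)
Lemma dual_eq_dense (X : normedModType K) (f g : dual_space X) (S : set X) :
  (forall x e, 0 < e -> exists2 y, S y & `|x - y| < e) ->
  (forall y, S y -> f y = g y) -> f = g.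
Proof.
move=> Sd fg; apply: dual_ext => x; apply/eqP; rewrite -subr_eq0 -normr_le0.
apply/ler_addgt0Pr => e e0; rewrite add0r.
have N0 : 0 < opnorm (f - g) + 1 by rewrite ltr_wpDl// opnorm_ge0.
have [y Sy xy] := Sd x (e / (opnorm (f - g) + 1)) (divr_gt0 e0 N0).
have -> : f x - g x = (f - g) (x - y).
  by rewrite dualB [(f - g) y](_ : _ = f y - g y)// (fg _ Sy) subrr subr0.
rewrite (le_trans (le_opnorm _ _))//.
rewrite (@le_trans _ _ ((opnorm (f - g) + 1) * `|x - y|))//.
  by rewrite ler_wpM2r// lerDl.
by rewrite mulrC -ler_pdivlMr// ltW.
Qed.

(** The uniform bound carries convergence from the dense set [S] to every point by a Cauchy
    argument; linearity and the bound then pass to the limit. *)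
Lemma dual_pointwise_limit (X : normedModType K) (T : Type) (F : set_system T)
    (FF : ProperFilter F) (f : T -> dual_space X) (M : K) (S : set X) :
  0 <= M -> (forall t x, `|f t x| <= M * `|x|) ->
  (forall x e, 0 < e -> exists2 y, S y & `|x - y| < e) ->
  (forall y, S y -> exists l : K^o, (f t y : K^o) @[t --> F] --> l) ->
  exists2 l : dual_space X,
    forall x, (f t x : K^o) @[t --> F] --> (l x : K^o) &
    forall x, `|l x| <= M * `|x|.
Proof.
move=> M0 fM Sd Sf.
have /choice[l fl] : forall x, exists l : K^o, (f t x : K^o) @[t --> F] --> l.
  move=> x; pose G : set_system K^o := (fun t => f t x) @ F.
  have GF : ProperFilter G by exact: fmap_proper_filter.
  suff Gc : cauchy G by exists (lim G); exact: (@scalar_complete R k G GF Gc).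
  apply/cauchyP => e e0.
  have M1 : 0 < M + 1 by rewrite ltr_wpDl.
  (* Half of [e] pays for convergence at [y], half for replacing [x] by [y] under the bound [M]. *)
  have d0 : 0 < e / 2 / (M + 1) by rewrite !divr_gt0.
  have [y Sy xy] := Sd x _ d0.
  have [l fl] := Sf y Sy; exists l.
  change (F [set t | `|l - f t x| < e]).
  have e20 : 0 < e / 2 by rewrite divr_gt0.
  have Fl := iffLR (@cvgrPdist_lt K K^o _ F FF _ l) fl _ e20.
  apply: filterS Fl => t /= lt; rewrite (le_lt_trans (ler_distD (f t y) _ _))//.
  rewrite [ltRHS]splitr ltrD//.
  rewrite distrC -dualB (le_lt_trans (fM t _))//.
  rewrite (@le_lt_trans _ _ ((M + 1) * `|x - y|))//.
    by rewrite ler_wpM2r// lerDl.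
  by rewrite mulrC -ltr_pdivlMr.
have l_lin : linear l.
  move=> a x y; apply: (@cvg_unique _ (@norm_hausdorff K K^o) _ _ _ _ (fl _)).
  rewrite (_ : (fun t => f t (a *: x + y)) =
    (fun t => a *: f t x + f t y)); last first.
    by apply/funext => t; exact: dual_linear.
  by apply: cvgD; [apply: cvgZl_tmp; exact: fl|exact: fl].
have lM x : `|l x| <= M * `|x|.
  apply/ler_addgt0Pr => e e0.
  have Fl := iffLR (@cvgrPdist_lt K K^o _ F FF _ (l x)) (fl x) _ e0.
  near F => t.
  rewrite -[l x](subrK (f t x)) (le_trans (ler_normD _ _))//.
  by rewrite addrC lerD ?fM//; apply: ltW; near: t.
by exists (Dual (bounded_in_dual M0 l_lin lM)).
Unshelve. all: by end_near. Qed.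

(** Composing with [f] turns a derivation into the dual of [Y] into one into the dual of [X]; if [u]
    implements the latter, [u \o g] implements the former. *)
Lemma H1_trivial_dual_iso (B : banachAlgType K) (X Y : banach_bimodule B)
    (f : X -> Y) (g : Y -> X) :
  linear f -> linear g -> (forall x, `|f x| = `|x|) -> cancel f g ->
  cancel g f -> (forall b x, f (b *>> x) = b *>> f x) ->
  (forall b x, f (x <<* b) = f x <<* b) ->
  H1_trivial (dual_bimodule X) -> H1_trivial (dual_bimodule Y).
Proof.
move=> fl gl fn fK gK fL fR HX D [Dl Dc Dd].
have gn y : `|g y| = `|y| by rewrite -[in RHS](gK y) fn.
have pullP (Z Z' : normedModType K) (h : Z -> Z') (u : dual_space Z') :
    linear h -> (forall z, `|h z| = `|z|) -> (u \o h : Z -> K^o) \in dual_pred Z.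
  move=> hl hn; apply: (@bounded_in_dual _ _ _ _ (opnorm u)).
  - exact: opnorm_ge0.
  - by move=> a x y /=; rewrite hl dual_linear.
  - by move=> x /=; rewrite -hn le_opnorm.
pose D' (b : B) : dual_space X := Dual (pullP _ _ f (D b) fl fn).
have D'P : derivation (X := dual_bimodule X) D'.
  split.
  - by move=> a b c; apply: dual_ext => x /=; rewrite Dl.
  - move=> b; apply/cvgrPdist_le => e e0.
    have /cvgrPdist_le/(_ e e0) := Dc b; apply: filterS => c bc.
    apply: opnorm_le => [|x]; first exact: ltW.
    apply: le_trans (_ : `|(D b - D c) (f x)| <= _); first by [].
    rewrite (le_trans (le_opnorm _ _))// fn ler_wpM2r//.
  - move=> a b; apply: dual_ext => x /=; rewrite Dd.
    by rewrite -[LHS]/(D b (f x <<* a) + D a (b *>> f x)) -fL -fR.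
have [u Du] := HX D' D'P.
exists (Dual (pullP _ _ g u gl gn)) => b; apply: dual_ext => y.
have -> : D b y = D' b (g y) by rewrite /= gK.
rewrite Du -[LHS]/(u (g y <<* b) - u (b *>> g y)).
rewrite -[RHS]/(u (g (y <<* b)) - u (g (b *>> y))).
by congr (u _ - u _); apply: (can_inj fK); rewrite ?fL ?fR !gK.
Qed.

End Dual.

(** * Derivations on [J] and on [A] with values in a dual bimodule *)

Lemma ideal_val_continuous (K : numFieldType) (B : banachAlgType K)
  (I : closed_ideal B) : continuous (@ideal_val K B I).
Proof.
move=> x; apply/(@cvgrPdist_lt _ _ _ (nbhs x) (nbhs_filter x)) => r r0.
by apply/nbhs_normP; exists r.
Qed.

Section DerivationExtension.
Variables (R : realType) (k : scalar_kind).
Let K : numFieldType := scalar_field R k.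
Variables (A : banachAlgType K) (J : closed_ideal A) (X : banach_bimodule A).
Variables (T : Type) (F : set_system T) (FF : ProperFilter F).
Variables (e : T -> ideal_type J) (M : K).
Hypothesis eM : forall t, `|e t| <= M.
Hypothesis eJ : forall j, j ** e t @[t --> F] --> j.
Hypothesis eX : forall x : X, ideal_val (e t) *>> x @[t --> F] --> x.
Hypothesis Xe : forall x : X, x <<* ideal_val (e t) @[t --> F] --> x.

(* [dual_space Y] is convertible to [dual_space X], but their module actions agree
   only up to [dual_ext], because the [dual_funP] proofs they carry differ. *)
Let Y : banach_bimodule (ideal_type J) := restrict_bimodule J X.

(** Single products, with no linear span, are already dense because [x <<* e t] tends to [x]. *)
Let XJ : set X := [set z | exists y (j : ideal_type J), z = y <<* ideal_val j].

Let XJ_dense (x : X) r : 0 < r -> exists2 y, XJ y & `|x - y| < r.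
Proof.
move=> r0; have Fx := iffLR (@cvgrPdist_lt K X _ F FF _ x) (@Xe x) r r0.
have [t xt] := filter_ex Fx.
by exists (x <<* ideal_val (e t)) => //; exists x, (e t).
Qed.

Let jmulr (j : ideal_type J) (a : A) : ideal_type J :=
  to_ideal (ideal_mulr a (ideal_setP j)).

Lemma H1_trivial_dual_of_restrict :
  H1_trivial (dual_bimodule Y) -> H1_trivial (dual_bimodule X).
Proof.
move=> HY D [Dl Dc Dd].
have DE a b x : D (a ** b) x = D b (x <<* a) + D a (b *>> x) by rewrite Dd.
pose DJ (j : ideal_type J) : dual_space Y := D (ideal_val j).
have [|u Du] := HY DJ.
  split.
  - by move=> c i j; exact: Dl.
  - by move=> j; apply: continuous_comp; [exact: ideal_val_continuous|exact: Dc].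
  - by move=> i j; apply: dual_ext => x; exact: DE.
have DuE (j : ideal_type J) (x : X) : D (ideal_val j) x =
    (u : dual_space X) (x <<* ideal_val j) - (u : dual_space X) (ideal_val j *>> x).
  by rewrite -[D _]/(DJ j) Du.
exists u => a; apply: (dual_eq_dense XJ_dense) => _ [y [j ->]].
rewrite -[RHS]/((u : dual_space X) (y <<* ideal_val j <<* a) -
  (u : dual_space X) (a *>> (y <<* ideal_val j))).
have -> : D a (y <<* ideal_val j) =
    D (ideal_val (jmulr j a)) y - D (ideal_val j) (a *>> y).
  by rewrite -[ideal_val (jmulr j a)]/(ideal_val j ** a) DE addrK.
(* The two terms at [j *>> (a *>> y)] cancel. *)
by rewrite !DuE /= ractA lactA lract opprB addrA subrK.
Qed.

Section Extension.
Variable D : ideal_type J -> dual_space X.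
Hypothesis D_der : derivation (X := dual_bimodule Y) D.

Let D_lin : linear D. Proof. by case: D_der. Qed.

Let DE i j x : D (i ** j) x = D j (x <<* ideal_val i) + D i (ideal_val j *>> x).
Proof. by case: D_der => _ _ ->. Qed.

Let D_bounded : exists2 C, 0 < C & forall j x, `|D j x| <= C * (`|j| * `|x|).
Proof.
pose Dl : {linear ideal_type J -> dual_space X} :=
  HB.pack D (GRing.isLinear.Build _ _ _ _ _ D_lin).
have /linear_boundedP/pinfty_ex_gt0[C C0 DC] : bounded_near Dl (nbhs 0).
  by apply: continuous_linear_bounded; case: D_der => _ + _; apply.
exists C => // j x; rewrite (le_trans (le_opnorm _ _))// mulrA ler_wpM2r//.
exact: DC.
Qed.

(** For an extension [D'] of [D], the Leibniz rule for [e t ** a] forces [D' a (x <<* e t)] to be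
    [G a t x], so [D' a x] must be its limit. *)
Let G (a : A) t : dual_space X :=
  D (jmulr (e t) a) - dual_ract (D (e t)) a.

Let GE a t x : G a t x = D (jmulr (e t) a) x - D (e t) (a *>> x).
Proof. by []. Qed.

Let D_cvg u (j : ideal_type J) x : u t @[t --> F] --> j ->
  (D (u t) x : K^o) @[t --> F] --> (D j x : K^o).
Proof.
move=> uj; have [C C0 DC] := D_bounded; apply/cvgrPdist_lt => r r0.
(* The [+ 1] keeps the divisor positive at [x = 0]. *)
have d0 : 0 < r / (C * (`|x| + 1)) by rewrite divr_gt0// mulr_gt0// ltr_wpDl.
apply: filterS (iffLR (@cvgrPdist_lt K _ _ F FF _ j) uj _ d0) => t /= ut.
have -> : D j x - D (u t) x = D (j - u t) x.
  by have := D_lin (-1) (u t) j; rewrite !scaleN1r ![- _ + _]addrC => ->.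
rewrite (le_lt_trans (DC _ _))// mulrCA.
move: ut; rewrite ltr_pdivlMr; last by rewrite mulr_gt0// ltr_wpDl.
by apply: le_lt_trans; rewrite ler_wpM2l// ler_pM2l// lerDl.
Qed.

(* Along the approximate identity, [D (j ** e t ** a)] and [D (j ** e t)] converge,
   and the Leibniz rule expresses [G a t (y <<* j)] through them. *)
Let G_cvg a y (j : ideal_type J) :
  (G a t (y <<* ideal_val j) : K^o) @[t --> F] -->
  (D (jmulr j a) y - D j (a *>> y) : K^o).
Proof.
(* Each bracket is one term of [G], obtained from the Leibniz rule for [j ** jmulr (e t) a] at [y]
   and for [j ** e t] at [a *>> y]. *)
have -> : (fun t => G a t (y <<* ideal_val j)) = (fun t =>
    (D (jmulr (j ** e t) a) y - D j (ideal_val (e t) *>> (a *>> y))) -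
    (D (j ** e t) (a *>> y) - D j (ideal_val (e t) *>> (a *>> y)))).
  apply/funext => t; rewrite GE.
  have -> : jmulr (j ** e t) a = j ** jmulr (e t) a.
    by apply: val_inj; rewrite /= -bmulA.
  by rewrite !DE -lactA lract !addrK.
have Dj : (D j (ideal_val (e t) *>> (a *>> y)) : K^o) @[t --> F] -->
    (D j (a *>> y) : K^o).
  by apply: continuous_cvg; [exact: dual_continuous|exact: eX].
(* The limit takes the four-term shape of the function: both terms subtracted inside the brackets
   tend to [D j (a *>> y)]. *)
rewrite -[X in _ --> X]subr0 -[X in _ - X](subrr (D j (a *>> y))).
apply: cvgB; apply: cvgB => //; apply: D_cvg => //.
have := @eJ j => /cvgrPdist_lt ej; apply/cvgrPdist_lt => r r0.
have d0 : 0 < r / (`|a| + 1) by rewrite divr_gt0// ltr_wpDl.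
apply: filterS (ej _ d0) => t; rewrite ltr_pdivlMr ?ltr_wpDl// => jt.
have -> : jmulr j a - jmulr (j ** e t) a = jmulr (j - j ** e t) a.
  apply: val_inj; rewrite /=.
  have := bmul_linearl a (-1) (ideal_val (j ** e t)) (ideal_val j).
  by rewrite /= !scaleN1r ![- _ + _]addrC => ->.
rewrite (le_lt_trans (normr_bmul_le _ _))//; apply: le_lt_trans jt.
by rewrite ler_wpM2l// lerDl.
Qed.

Let G_bounded : exists2 C, 0 <= C & forall a t x, `|G a t x| <= C * `|a| * `|x|.
Proof.
have [C C0 DC] := D_bounded.
have [N N0 XN] := bilinear_continuous_bounded (@lact_linearl _ _ X)
  (@lact_linearr _ _ X) (@lact_continuous _ _ X).
have M0 : 0 <= M.
  by have [t _] := filter_ex (@filterT _ F FF); exact: le_trans (eM t).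
(* [C] bounds [D], [M] the net and [N] the left action; the [1] comes from [D (jmulr (e t) a) x],
   the [N] from [D (e t) (a *>> x)]. *)
exists (C * M * (1 + N)) => [|a t x].
  by rewrite !mulr_ge0// ?addr_ge0// ltW.
have -> : C * M * (1 + N) * `|a| * `|x| =
    C * (M * `|a| * `|x|) + C * (M * (N * (`|a| * `|x|))).
  by rewrite mulrDr mulr1 !mulrDl !mulrA.
rewrite GE (le_trans (ler_normB _ _))// lerD//.
  rewrite (le_trans (DC _ _))// ler_pM2l// ler_wpM2r//.
  apply: le_trans (normr_bmul_le (ideal_val (e t)) a) _.
  exact: ler_wpM2r (eM t).
by rewrite (le_trans (DC _ _))// ler_pM2l// ler_pM.
Qed.

Lemma extend_derivation : exists2 D' : A -> dual_space X,
  derivation (X := dual_bimodule X) D' & forall j, D' (ideal_val j) = D j.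
Proof.
have [C C0 GC] := G_bounded.
have /choice[L LP] a : exists l : dual_space X,
    (forall x, (G a t x : K^o) @[t --> F] --> (l x : K^o)) /\
    forall x, `|l x| <= C * `|a| * `|x|.
  have [||||l l1 l2] := @dual_pointwise_limit R k X T F FF (G a) (C * `|a|) XJ.
  - exact: mulr_ge0.
  - exact: GC.
  - exact: XJ_dense.
  - by move=> _ [y [j ->]]; exists (D (jmulr j a) y - D j (a *>> y)); exact: G_cvg.
  - by exists l.
(* Uniqueness of limits gives a closed formula on [XJ]; linearity, the Leibniz rule and the
   extension property of [L] follow from it by density. *)
have LE a y j : L a (y <<* ideal_val j) = D (jmulr j a) y - D j (a *>> y).
  exact: (@cvg_unique _ (@norm_hausdorff K K^o) _ _ _ _ ((LP a).1 _)
    (@G_cvg a y j)).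
have L_lin : linear L.
  move=> c a b; apply: (dual_eq_dense XJ_dense) => _ [y [j ->]].
  rewrite -[RHS]/(c *: L a (y <<* ideal_val j) + L b (y <<* ideal_val j)) !LE.
  have -> : jmulr j (c *: a + b) = c *: jmulr j a + jmulr j b.
    by apply: val_inj; rewrite /= bmul_linearr.
  rewrite D_lin lact_linearl dual_linear.
  by rewrite scalerBr opprD addrACA.
exists L.
  split=> //.
  - pose Ll : {linear A -> dual_space X} :=
      HB.pack L (GRing.isLinear.Build _ _ _ _ _ L_lin).
    apply: (@bounded_linear_continuous _ _ _ Ll); apply/linear_boundedP.
    near=> r; move=> a /=; rewrite (@le_trans _ _ (C * `|a|))//.
      by apply: opnorm_le; [exact: mulr_ge0|exact: (LP a).2].
    rewrite ler_wpM2r//.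
    by near: r; apply: nbhs_pinfty_ge; rewrite ger0_real.
  - move=> a b; apply: (dual_eq_dense XJ_dense) => _ [y [j ->]].
    rewrite -[RHS]/(L b (y <<* ideal_val j <<* a) +
      L a (b *>> (y <<* ideal_val j))).
    (* Both arguments are again in [XJ], and the terms [D (jmulr j a) (b *>> y)] cancel. *)
    rewrite ractA -[_ ** a]/(ideal_val (jmulr j a)) -lract !LE lactA.
    have -> : jmulr (jmulr j a) b = jmulr j (a ** b).
      by apply: val_inj; rewrite /= bmulA.
    by rewrite addrA subrK.
move=> i; apply: (dual_eq_dense XJ_dense) => _ [y [j ->]].
(* For [i] in [J], [LE] is the Leibniz rule of [D] for [j ** i]. *)
have ji : jmulr j (ideal_val i) = j ** i by exact: val_inj.
by rewrite LE ji DE addrK.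
Unshelve. all: by end_near. Qed.

End Extension.

(** From right to left, a functional implementing the extension of [D] also implements [D]. *)
Lemma H1_trivial_dual_restrict :
  H1_trivial (dual_bimodule Y) <-> H1_trivial (dual_bimodule X).
Proof.
split=> [|HX D Dder]; first exact: H1_trivial_dual_of_restrict.
have [D' D'der D'E] := extend_derivation Dder.
have [u Du] := HX D' D'der; exists u => j.
by apply: dual_ext => x; rewrite -D'E Du.
Qed.

End DerivationExtension.

(** * Application to the ideal [I] *)

Theorem theorem1p13 (R : realType) (k : scalar_kind)
    (A : banachAlgType (scalar_field R k)) (J : closed_ideal A)
    (J_bai : has_bai (ideal_type J)) (I : closed_ideal (ideal_type J)) :
  ideal_weakly_amenable (ideal_type J) I <->
  ideal_weakly_amenable A (ideal_lift J_bai I).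
Proof.
pose X := ideal_bimodule (ideal_lift J_bai I).
have [T [le [e [M [le_dir eM eJ Je]]]]] := J_bai.
have FF := net_tails_filter le_dir.
(* [I] and its lift have the same elements of [A] under different types; [f] and [g] are the inverse
   isometries between them. *)
have XI (x : X) : exists y : ideal_type I,
    ideal_val (ideal_val y) = ideal_val x.
  by have [y Iy yx] := ideal_setP x; exists (to_ideal Iy).
have /choice[g gE] := XI.
have IX (y : ideal_type I) :
    ideal_set (ideal_lift J_bai I) (ideal_val (ideal_val y)).
  by exists (ideal_val y) => //; exact: ideal_setP.
pose f (y : ideal_type I) : X := to_ideal (IX y).
have gf : cancel g f by move=> x; apply: val_inj; exact: gE.
have fg : cancel f g by move=> y; do 2 apply: val_inj; exact: (gE (f y)).
have f_lin : linear f by move=> c y z; exact: val_inj.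
have g_lin : linear g.
  by move=> c x y; apply: (can_inj fg); rewrite f_lin !gf.
have fn y : `|f y| = `|y| by [].
have fL (b : ideal_type J) (y : ideal_bimodule I) :
    f (b *>> y) = (b : ideal_type J) *>> (f y : restrict_bimodule J X).
  exact: val_inj.
have fR (b : ideal_type J) (y : ideal_bimodule I) :
    f (y <<* b) = (f y : restrict_bimodule J X) <<* b.
  exact: val_inj.
(* First [I] is identified with [X] as a [J]-bimodule, then [J] and [A] are compared on [X]. *)
apply: (@iff_trans _ (H1_trivial (dual_bimodule (restrict_bimodule J X)))).
  split.
    exact: (@H1_trivial_dual_iso R k _ (ideal_bimodule I)
      (restrict_bimodule J X) f g f_lin g_lin fn fg gf fL fR).
  apply: (@H1_trivial_dual_iso R k _ (restrict_bimodule J X)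
    (ideal_bimodule I) g f g_lin f_lin) => // [x|b x|b x].
  - by rewrite -fn gf.
  - by apply: (can_inj fg); rewrite fL !gf.
  - by apply: (can_inj fg); rewrite fR !gf.
(* Elements of [X] lie in [J], with the same norm, so the approximate identity of [J] also acts as
   one on [X]. *)
have XJ (x : X) : ideal_set J (ideal_val x).
  by have [y _ <-] := ideal_setP x; exact: ideal_setP.
apply: (H1_trivial_dual_restrict FF eM Je).
- move=> x; move: (eJ (to_ideal (XJ x))) => /cvgrPdist_lt ex.
  by apply/cvgrPdist_lt => r /ex.
- move=> x; move: (Je (to_ideal (XJ x))) => /cvgrPdist_lt ex.
  by apply/cvgrPdist_lt => r /ex.
Qed.
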